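(* Let $r,\kappa,\eta>0$, $L\ge 0$, $S>L$, $V>0$, and let $m_1,m_2\ge 3$ be integers. Set $\Delta s=(S-L)/(m_1+1)$, $\Delta v=V/(m_2+1)$, $s_i=L+i\Delta s$ ($1\le i\le m_1$), $v_j=j\Delta v$ ($1\le j\le m_2$), $D_1=\mathrm{diag}(s_1,\dots,s_{m_1})$, $D_2=\mathrm{diag}(v_1,\dots,v_{m_2})$, $L_1=\frac{1}{2\Delta s}\,\mathrm{tridiag}(-1,0,1)$ (an $m_1\times m_1$ matrix) and $L_2=\frac{1}{2\Delta v}\,\mathrm{tridiag}(-1,0,1)$ (an $m_2\times m_2$ matrix). Define the real $m_1m_2\times m_1m_2$ matrices \[ A_1=r\,I\otimes(D_1L_1),\qquad A_2=\kappa\,[(\eta I-D_2)L_2]\otimes I . \] Then for all $t\ge 0$, \[ \|e^{tA_1}\|_2\le e^{t r/2}\quad\text{and}\quad \|e^{tA_2}\|_2\le e^{t\kappa/2}. \] Moreover, the values $\omega=r/2$ and $\omega=\kappa/2$ are the smallest values of $\omega$ for which the respective bounds $\|e^{tA_1}\|_2\le e^{t\omega}$, $\|e^{tA_2}\|_2\le e^{t\omega}$ (for all $t\ge0$) hold uniformly in the mesh widths, i.e. for all admissible $m_1,m_2$.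
   Context: $\otimes$ denotes the Kronecker product, $I$ the identity matrix of the appropriate dimension, and $\|\cdot\|_2$ the spectral norm (matrix norm induced by the Euclidean norm). $\mathrm{tridiag}(a,b,c)$ denotes the tridiagonal matrix with constant subdiagonal $a$, diagonal $b$ and superdiagonal $c$. *)

(* Defs.v *)
From HB Require Import structures.
From mathcomp Require Import all_boot all_order all_algebra.
From mathcomp Require Import all_classical all_reals all_analysis.
From mathcomp Require Import mxtens.
Set Implicit Arguments. Unset Strict Implicit. Unset Printing Implicit Defensive.
Import Order.TTheory GRing.Theory Num.Theory.
Import numFieldNormedType.Exports.
Local Open Scope ring_scope.
Local Open Scope classical_set_scope.

Section Defs.
Variable R : realType.

Definition mexp (n : nat) (A : 'M[R]_n) : 'M[R]_n :=
  limn (series (fun k : nat => (k`!%:R)^-1 *: A ^+ k)).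

Definition enorm (n : nat) (x : 'cV[R]_n) : R :=
  Num.sqrt (\sum_i x i 0 ^+ 2).

Definition specnorm (m n : nat) (M : 'M[R]_(m, n)) : R :=
  sup [set enorm (M *m x) | x in [set x : 'cV[R]_n | enorm x <= 1]].

Definition tridiag (n : nat) (a b c : R) : 'M[R]_n :=
  \matrix_(i, j) (if (j : nat) == i.+1 then c
                  else if (i : nat) == j.+1 then a
                  else if (i : nat) == j then b else 0).

Definition dS (L S : R) (m1 : nat) : R := (S - L) / (m1.+1)%:R.
Definition dV (V : R) (m2 : nat) : R := V / (m2.+1)%:R.

(* D1 = diag(s_1..s_m1), s_i = L + i ds, with 1-based i (ordinal i <-> i+1) *)
Definition D1 (L S : R) (m1 : nat) : 'M[R]_m1 :=
  diag_mx (\row_(i < m1) (L + (i.+1)%:R * dS L S m1)).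
Definition D2 (V : R) (m2 : nat) : 'M[R]_m2 :=
  diag_mx (\row_(j < m2) ((j.+1)%:R * dV V m2)).

Definition L1 (L S : R) (m1 : nat) : 'M[R]_m1 :=
  (2 * dS L S m1)^-1 *: tridiag m1 (-1) 0 1.
Definition L2 (V : R) (m2 : nat) : 'M[R]_m2 :=
  (2 * dV V m2)^-1 *: tridiag m2 (-1) 0 1.

Definition A1 (r L S : R) (m1 m2 : nat) : 'M[R]_(m2 * m1) :=
  r *: ((1%:M : 'M[R]_m2) *t (D1 L S m1 *m L1 L S m1)).
Definition A2 (kappa eta V : R) (m1 m2 : nat) : 'M[R]_(m2 * m1) :=
  kappa *: (((eta%:M - D2 V m2) *m L2 V m2) *t (1%:M : 'M[R]_m1)).

End Defs.

(* Main.v *)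
(** Write [q_A(x) = <x, A x>] and [|x|] for the Euclidean norm. Since
    [d/dt |e^(tA) x|^2 = 2 q_A(e^(tA) x)], the bound [||e^(tA)|| <= e^(t w)]
    holds for all [t >= 0] if and only if [q_A(x) <= w |x|^2] for all [x]: one
    direction is Gronwall's argument, the other compares derivatives at [t = 0].
    The diagonals of [D1] and of [eta I - D2] are arithmetic progressions with
    steps [ds] and [- dv], so the symmetric parts of [D1 L1] and
    [(eta I - D2) L2] are [tridiag(-1/4, 0, -1/4)] and [tridiag(1/4, 0, 1/4)].
    Their forms are [-/+ 1/2 sum x_i x_(i+1) <= 1/2 |x|^2], and the alternating
    vector, resp. the constant one, attains the ratio [(m - 1) / (2 m)], which
    tends to [1/2] as the mesh is refined. *)
Require Import Defs.
From HB Require Import structures.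
From mathcomp Require Import all_boot all_order all_algebra.
From mathcomp Require Import all_classical all_reals all_analysis.
From mathcomp Require Import mxtens.
From mathcomp Require Import ring lra.
Set Implicit Arguments. Unset Strict Implicit. Unset Printing Implicit Defensive.
Import Order.TTheory GRing.Theory Num.Theory.
Import numFieldNormedType.Exports.
Local Open Scope ring_scope.

(** A neighbourhood of [M] contains a product of neighbourhoods of its entries. These are finitely
    many, so the filter enters all of them at once. *)
Lemma cvg_mx_coord {T : Type} {F : set_system T} {FF : Filter F}
    (K : numFieldType) (m n : nat) (f : T -> 'M[K]_(m, n)) (M : 'M[K]_(m, n)) :
  (forall i j, (f x i j @[x --> F] --> M i j)%classic) ->
  (f x @[x --> F] --> M)%classic.
Proof.
move=> fM B [P PM PB].
have : \forall x \near F, forall i j, P i j (f x i j).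
  by apply: filter_forall => i; apply: filter_forall => j; exact: fM (PM i j).
by apply: filterS => x Px; exact: PB.
Qed.

(** * The matrix exponential as an entrywise power series *)

Section MatrixExponential.
Variables (R : realType) (n : nat) (A : 'M[R]_n).

Let c := \sum_i \sum_j `|A i j|.

(** The constant [c] dominates every absolute row sum of [A], so each further factor [A] multiplies
    the entrywise bound by at most [c]. *)
Lemma normr_expmx_le k i j : `|(A ^+ k) i j| <= c ^+ k.
Proof.
have c0 : 0 <= c by apply: sumr_ge0 => ? _; apply: sumr_ge0.
elim: k i j => [|k IH] i j.
  by rewrite !expr0 mxE normr_nat lern1 leq_b1.
rewrite !exprS mxE (le_trans (ler_norm_sum _ _ _))//.
rewrite (@le_trans _ _ (\sum_l `|A i l| * c ^+ k))//.
  by apply: ler_sum => l _; rewrite normrM ler_wpM2l.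
rewrite -mulr_suml ler_wpM2r ?exprn_ge0// /c [leRHS](bigD1 i)//= lerDl.
by apply: sumr_ge0 => ? _; apply: sumr_ge0.
Qed.

Lemma expmxZ (t : R) k : (t *: A) ^+ k = t ^+ k *: A ^+ k.
Proof.
elim: k => [|k IH]; first by rewrite !expr0 scale1r.
by rewrite !exprS IH -[LHS]scalemxAl -[X in t *: X]scalemxAr scalerA.
Qed.

(** The left factor [B] makes this family closed under termwise differentiation, which replaces [B]
    by [B *m A]. *)
Let coef (B : 'M[R]_n) i j (k : nat) : R := (k`!%:R)^-1 * (B *m A ^+ k) i j.

Lemma is_cvg_pseries_expmx (B : 'M[R]_n) i j (t : R) :
  cvgn (pseries (coef B i j) t).
Proof.
apply: normed_cvg.
pose b := \sum_l `|B i l|.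
have c0 : 0 <= c by apply: sumr_ge0 => ? _; apply: sumr_ge0.
have b0 : 0 <= b by apply: sumr_ge0.
(* The terms are dominated by those of the scalar series of [b * e^(c |t|)]. *)
pose v := b *: exp_coeff (c * `|t|).
apply: (@series_le_cvg _ _ v) => //=.
- by move=> k; rewrite mulr_ge0// exp_coeff_ge0// mulr_ge0.
- move=> k; rewrite /v [leRHS](_ : _ = b * ((c * `|t|) ^+ k / k`!%:R))//.
  rewrite /coef !normrM normrX normfV normr_nat exprMn.
  rewrite [leLHS](_ : _ = `|(B *m A ^+ k) i j| * (`|t| ^+ k / k`!%:R)); last ring.
  rewrite [leRHS](_ : _ = (b * c ^+ k) * (`|t| ^+ k / k`!%:R)); last ring.
  rewrite ler_wpM2r ?divr_ge0 ?exprn_ge0// mxE.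
  rewrite (le_trans (ler_norm_sum _ _ _))// /b mulr_suml.
  by apply: ler_sum => l _; rewrite normrM ler_wpM2l// normr_expmx_le.
- exact/is_cvg_seriesZ/is_cvg_series_exp_coeff.
Qed.

Lemma cvg_mexp_coord (t : R) i j :
  (pseries (coef 1%:M i j) t x @[x --> \oo] --> mexp (t *: A) i j)%classic.
Proof.
pose M := \matrix_(i, j) limn (pseries (coef 1%:M i j) t).
pose u := series (fun k : nat => (k`!%:R)^-1 *: (t *: A) ^+ k).
have uE k i' j' : u k i' j' = pseries (coef 1%:M i' j') t k.
  rewrite /u /pseries /series /= summxE; apply: eq_bigr => l _.
  by rewrite expmxZ mxE mxE /coef mul1mx mulrA mulrAC.
(* [mexp] is a [limn], so convergence of the matrix partial sums has to be known before its entries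
   can be read off by continuity of the coordinates. *)
have uM : (u k @[k --> \oo] --> M)%classic.
  apply: cvg_mx_coord => i' j'; under eq_fun do rewrite uE.
  by rewrite mxE; exact: is_cvg_pseries_expmx.
have um : (u k @[k --> \oo] --> mexp (t *: A))%classic by exact: (cvgP _ uM).
have := cvg_comp u (fun N : 'M[R]_n => N i j) um (@coord_continuous _ _ _ i j _).
by apply: cvg_trans; apply: near_eq_cvg; near=> k; rewrite /= uE.
Unshelve. all: by end_near. Qed.

Lemma cvg_mulmx_mexp_coord (B : 'M[R]_n) (t : R) i j :
  (pseries (coef B i j) t x @[x --> \oo] --> (B *m mexp (t *: A)) i j)%classic.
Proof.
rewrite mxE [X in (X @ _ --> _)%classic](_ : _ =
    fun x => \sum_l B i l * pseries (coef 1%:M l j) t x).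
  apply: cvg_big => [|l _]; first exact: add_continuous.
  apply: cvgM; [exact: cvg_cst|exact: cvg_mexp_coord].
apply/funext => x; under eq_bigr do rewrite mulr_sumr.
rewrite exchange_big /=; apply: eq_bigr => k _.
rewrite /coef /= [(B *m _) i j]mxE mulr_sumr mulr_suml; apply: eq_bigr => l _.
by rewrite mul1mx; ring.
Qed.

Lemma is_derive_mexp_coord (t : R) i j :
  is_derive t 1 (fun s => mexp (s *: A) i j) ((A *m mexp (t *: A)) i j).
Proof.
have dE B : pseries_diffs (coef B i j) = coef (B *m A) i j.
  apply/funext => k; rewrite /pseries_diffs /coef factS natrM invfM mulrA.
  rewrite mulrA divff ?mul1r// exprS; congr (_ * _).
  by rewrite -mulmxA.
rewrite (_ : (fun s => _) = fun s => limn (pseries (coef 1%:M i j) s)); last first.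
  apply/funext => s; apply/esym/cvg_lim => //; exact: cvg_mexp_coord.
have -> : (A *m mexp (t *: A)) i j = limn (pseries (pseries_diffs (coef 1%:M i j)) t).
  rewrite dE mul1mx; apply/esym/cvg_lim => //; exact: cvg_mulmx_mexp_coord.
(* Termwise differentiation at [t] asks the series and its first two formal derivatives to converge
   at a point of modulus greater than [|t|]. They converge everywhere, so [|t| + 1] serves. *)
apply: (@pseries_snd_diffs _ _ (`|t| + 1)); rewrite ?dE; 
  try exact: is_cvg_pseries_expmx.
by rewrite [ltRHS]ger0_norm ?addr_ge0// ltrDl.
Qed.

Lemma mexp0 : mexp (0 *: A) = 1%:M.
Proof.
apply/matrixP => i j; have := @cvg_mexp_coord 0 i j.
move/(cvg_lim (@norm_hausdorff _ _)) => <-.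
apply: lim_near_cst => //; near=> k.
rewrite -[k]prednK; last by near: k.
rewrite /pseries /series /= big_nat_recl//= big1; last first.
  by move=> l _; rewrite expr0n mulr0.
by rewrite /coef fact0 invr1 !expr0 mul1mx mulr1 mul1r addr0.
Unshelve. all: by end_near. Qed.

End MatrixExponential.

(** * Exponential growth bounds and quadratic forms *)

Section LogarithmicNorm.
Variable R : realType.

Definition sqnorm n (x : 'cV[R]_n) : R := \sum_i x i 0 ^+ 2.

Definition quadform n (A : 'M[R]_n) (x : 'cV[R]_n) : R :=
  \sum_i x i 0 * (A *m x) i 0.

Lemma sqnorm_ge0 n (x : 'cV[R]_n) : 0 <= sqnorm x.
Proof. by apply: sumr_ge0 => i _; exact: sqr_ge0. Qed.

Lemma sqnormZ n (a : R) (x : 'cV[R]_n) : sqnorm (a *: x) = a ^+ 2 * sqnorm x.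
Proof. by rewrite /sqnorm mulr_sumr; apply: eq_bigr => i _; rewrite mxE exprMn. Qed.

Lemma sqnorm0 n : sqnorm (0 : 'cV[R]_n) = 0.
Proof. by rewrite /sqnorm big1// => i _; rewrite mxE expr0n. Qed.

Lemma enorm_le1 n (x : 'cV[R]_n) : (enorm x <= 1) = (sqnorm x <= 1).
Proof. by rewrite /enorm -[in LHS]sqrtr1 ler_sqrt. Qed.

(** Needed for the [sup] in [specnorm] to be a genuine supremum. On the unit ball every coordinate
    of [x] has modulus at most 1, so each entry of [M *m x] is bounded by an absolute row sum. *)
Lemma has_ubound_specnorm m n (M : 'M[R]_(m, n)) :
  has_ubound [set enorm (M *m x) | x in [set x : 'cV[R]_n | enorm x <= 1]]%classic.
Proof.
exists (Num.sqrt (\sum_i (\sum_j `|M i j|) ^+ 2)) => _ [x /= + <-].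
rewrite enorm_le1 => x1; rewrite ler_wsqrtr//; apply: ler_sum => i _.
rewrite -real_normK ?num_real// lerXn2r ?nnegrE//; first exact: sumr_ge0.
rewrite mxE (le_trans (ler_norm_sum _ _ _))//; apply: ler_sum => j _.
rewrite normrM ler_piMr// -(@ler_pXn2r _ 2) ?nnegrE// expr1n real_normK ?num_real//.
by apply: le_trans x1; rewrite /sqnorm (bigD1 j)//= lerDl sumr_ge0// => *; exact: sqr_ge0.
Qed.

Lemma specnorm_ge0 m n (M : 'M[R]_(m, n)) : 0 <= specnorm M.
Proof.
apply: le_trans (_ : enorm (M *m 0) <= _); first exact: sqrtr_ge0.
apply: ub_le_sup; first exact: has_ubound_specnorm.
by exists 0 => //=; rewrite enorm_le1 sqnorm0.
Qed.

(** Homogeneity extends the bound from the unit ball to all vectors; the zero vector cannot be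
    normalised and is treated apart. *)
Lemma sqnorm_mulmx_le m n (M : 'M[R]_(m, n)) (x : 'cV[R]_n) :
  sqnorm (M *m x) <= specnorm M ^+ 2 * sqnorm x.
Proof.
have unit_le (z : 'cV[R]_n) : sqnorm z <= 1 -> sqnorm (M *m z) <= specnorm M ^+ 2.
  rewrite -enorm_le1 => z1.
  have Mz : enorm (M *m z) <= specnorm M.
    by apply: ub_le_sup; [exact: has_ubound_specnorm|exists z].
  by rewrite -[leLHS]sqr_sqrtr ?sqnorm_ge0// lerXn2r ?nnegrE ?sqrtr_ge0// specnorm_ge0.
have [x0|x_neq0] := eqVneq (sqnorm x) 0.
  have -> : x = 0.
    apply/matrixP => i j; rewrite ord1 mxE; apply/eqP.
    move/eqP: x0; rewrite psumr_eq0 => [|*]; last exact: sqr_ge0.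
    by move/allP/(_ i); rewrite mem_index_enum sqrf_eq0; exact.
  by rewrite mulmx0 !sqnorm0 mulr0.
have x_gt0 : 0 < sqnorm x by rewrite lt_neqAle eq_sym x_neq0 sqnorm_ge0.
have /unit_le : sqnorm ((Num.sqrt (sqnorm x))^-1 *: x) <= 1.
  by rewrite sqnormZ exprVn sqr_sqrtr ?sqnorm_ge0// mulVf.
rewrite -scalemxAr sqnormZ exprVn sqr_sqrtr ?sqnorm_ge0//.
by rewrite mulrC ler_pdivrMr.
Qed.

Lemma specnorm_le m n (M : 'M[R]_(m, n)) (a : R) : 0 <= a ->
  (forall x, sqnorm (M *m x) <= a ^+ 2 * sqnorm x) -> specnorm M <= a.
Proof.
move=> a0 Ma; apply: ge_sup.
  by exists (enorm (M *m 0)), 0 => //=; rewrite enorm_le1 sqnorm0.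
move=> _ [x /= + <-]; rewrite enorm_le1 => x1.
rewrite -[a]ger0_norm// -sqrtr_sqr ler_wsqrtr// (le_trans (Ma x))//.
by rewrite ler_piMr// sqr_ge0.
Qed.

Lemma is_derive_mexp_mulmx n (A : 'M[R]_n) (x : 'cV[R]_n) (t : R) i :
  is_derive t 1 (fun s => (mexp (s *: A) *m x) i 0)
    ((A *m (mexp (t *: A) *m x)) i 0).
Proof.
rewrite (_ : (fun s => _) = \sum_j (x j 0 \*: (fun s => mexp (s *: A) i j))); last first.
  apply/funext => s; rewrite fct_sumE mxE; apply: eq_bigr => j _.
  by rewrite /= mulrC.
apply: (is_derive_eq (is_derive_sum (fun j => is_deriveZ _ (is_derive_mexp_coord A t i j)))).
by rewrite mulmxA [RHS]mxE; apply: eq_bigr => j _; rewrite mulrC.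
Qed.

Lemma is_derive_sqnorm_mexp n (A : 'M[R]_n) (x : 'cV[R]_n) (t : R) :
  is_derive t 1 (fun s => sqnorm (mexp (s *: A) *m x))
    (2 * quadform A (mexp (t *: A) *m x)).
Proof.
rewrite (_ : (fun s => _) = \sum_i ((fun s => (mexp (s *: A) *m x) i 0) ^+ 2)); last first.
  by apply/funext => s; rewrite fct_sumE; apply: eq_bigr => i _; rewrite exprfctE.
apply: (is_derive_eq (is_derive_sum (fun i => is_deriveX _ (is_derive_mexp_mulmx A x t i)))).
rewrite /quadform mulr_sumr; apply: eq_bigr => i _.
by rewrite expr1 mulrA.
Qed.

Lemma is_derive_expRM (a t : R) :
  is_derive t 1 (fun s => expR (s * a)) (a * expR (t * a)).
Proof.
have h : is_derive t 1 (fun s : R => s * a) a.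
  rewrite (_ : (fun s => _) = a \*: id); last first.
    by apply/funext => s; rewrite /= mulrC.
  by apply: is_derive_eq; rewrite /GRing.scale/= mulr1.
by apply: is_derive_eq (is_derive1_comp (is_derive_expR _) h) _; rewrite mulrC.
Qed.

(** With the integrating factor [e^(-2ws)], the function [|e^(sA) x|^2 e^(-2ws)] has derivative
    [2 e^(-2ws) (q_A - w |.|^2)], taken at [e^(sA) x]. This is nonpositive, so the value at [t] is
    at most the value [|x|^2] at 0. *)
Lemma specnorm_mexp_le n (A : 'M[R]_n) (w : R) :
  (forall x, quadform A x <= w * sqnorm x) ->
  forall t : R, 0 <= t -> specnorm (mexp (t *: A)) <= expR (t * w).
Proof.
move=> Aw t t0; apply: specnorm_le => [|x]; first exact: expR_ge0.
pose N (s : R) := sqnorm (mexp (s *: A) *m x).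
pose E (s : R) := expR (s * (- (2 * w))).
have dE (s : R) : is_derive s 1 E (- (2 * w) * E s) by exact: is_derive_expRM.
have dN (s : R) : is_derive s 1 N (2 * quadform A (mexp (s *: A) *m x)).
  exact: is_derive_sqnorm_mexp.
have dg (s : R) : is_derive s 1 (N * E) (N s *: (- (2 * w) * E s) +
    E s *: (2 * quadform A (mexp (s *: A) *m x))) by exact: is_deriveM.
have gle : (N * E) t <= (N * E) 0.
  apply: (@ler0_derive1_nincr _ (N * E) 0 t) => //.
  - move=> s _; have [_] := dg s; rewrite derive1E => ->.
    rewrite /GRing.scale/=.
    have -> : N s * (- (2 * w) * E s) + E s * (2 * quadform A (mexp (s *: A) *m x))
      = E s * 2 * (quadform A (mexp (s *: A) *m x) - w * N s) by ring.
    by rewrite pmulr_rle0 ?mulr_gt0 ?expR_gt0// subr_le0.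
  - apply: derivable_within_continuous => s _; have [d _] := dg s; exact: d.
move: gle; rewrite !mulrfctE /N /E mexp0 mul1mx mul0r expR0 mulr1.
rewrite mulrN expRN ler_pdivrMr ?expR_gt0// mulrC => /le_trans; apply.
by rewrite -expRM_natl mulrCA.
Qed.

(** The derivative is the limit of the right difference quotients [f h / h], all of which are
    nonnegative. *)
Lemma is_derive_ge0_right (f : R -> R) (df : R) : f 0 = 0 ->
  is_derive (0 : R) 1 f df -> (forall t : R, 0 <= t -> 0 <= f t) -> 0 <= df.
Proof.
move=> f0 [dfx <-] f_ge0; rewrite /derive.
have l := cvg_dnbhs_at_right dfx.
rewrite -(cvg_lim (@norm_hausdorff _ _) l); apply: limr_ge; first exact: cvgP l.
near=> h; have h0 : 0 <= h by near: h; exact: nbhs_right_ge.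
rewrite /= f0 subr0 addr0 /GRing.scale/= mulr1.
by rewrite mulr_ge0 ?invr_ge0 ?f_ge0.
Unshelve. all: by end_near. Qed.

Lemma quadform_le_specnorm_mexp n (A : 'M[R]_n) (w : R) :
  (forall t : R, 0 <= t -> specnorm (mexp (t *: A)) <= expR (t * w)) ->
  forall x, quadform A x <= w * sqnorm x.
Proof.
move=> Aw x.
(* The gap between the squared bound and the squared norm vanishes at 0 and is nonnegative
   afterwards, so its derivative at 0 is nonnegative. *)
pose f (t : R) := expR (t * (2 * w)) * sqnorm x - sqnorm (mexp (t *: A) *m x).
have df : is_derive (0 : R) 1 f (2 * w * sqnorm x - 2 * quadform A x).
  rewrite (_ : f = (sqnorm x \*: (fun t => expR (t * (2 * w)))) -
     (fun t => sqnorm (mexp (t *: A) *m x))); last first.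
    by apply/funext => s; rewrite /f /= mulrC.
  have d1 := is_derive_expRM (2 * w) 0; have d2 := is_derive_sqnorm_mexp A x 0.
  apply: is_derive_eq; rewrite mexp0 mul1mx mul0r expR0 mulr1.
  by rewrite /GRing.scale/= [sqnorm x * _]mulrC.
have : 0 <= 2 * w * sqnorm x - 2 * quadform A x.
  apply: is_derive_ge0_right df _ => [|t t0].
    by rewrite /f mexp0 mul1mx mul0r expR0 mul1r subrr.
  rewrite /f subr_ge0 (le_trans (sqnorm_mulmx_le _ _))// ler_wpM2r ?sqnorm_ge0//.
  rewrite mulrCA expRM_natl lerXn2r ?nnegrE ?expR_ge0 ?Aw ?specnorm_ge0//.
lra.
Qed.

End LogarithmicNorm.

(** * The quadratic form of a central difference with linear coefficient *)

Section CentralDifference.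
Variable R : realType.

(** This is [sum x_i x_(i+1)]. The indicator avoids forming successor ordinals and lets the two
    indices be exchanged freely. *)
Definition nbrsum n (x : 'cV[R]_n) : R :=
  \sum_(i < n) \sum_(j < n) ((j : nat) == i.+1)%:R * (x i 0 * x j 0).

Lemma sum_eq_nat n (k : nat) : \sum_(j < n) ((j : nat) == k)%:R = (k < n)%:R :> R.
Proof.
case: ltnP => [kn|nk].
  rewrite (bigD1 (Ordinal kn))//= eqxx big1 ?addr0// => j.
  by rewrite -val_eqE/= => /negbTE ->.
by rewrite big1// => j _; rewrite ltn_eqF// (leq_trans (ltn_ord j)).
Qed.

Lemma sum_succ_ord n (i : 'I_n) : \sum_(j < n) ((i : nat) == j.+1)%:R <= 1 :> R.
Proof.
case: i => -[|i] ni /=; first by rewrite big1.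
under eq_bigr => j _ do rewrite eqSS eq_sym.
by rewrite sum_eq_nat lern1 leq_b1.
Qed.

(** Each product satisfies [|x_i x_j| <= x_i^2 / 2 + x_j^2 / 2], and every index is at most once a
    left and at most once a right neighbour, so each half sums to at most half of [sqnorm x]. *)
Lemma normr_nbrsum_le n (x : 'cV[R]_n) : `|nbrsum x| <= sqnorm x.
Proof.
rewrite /nbrsum (le_trans (ler_norm_sum _ _ _))//.
rewrite (@le_trans _ _ (\sum_(i < n) \sum_(j < n) ((j : nat) == i.+1)%:R *
    (x i 0 ^+ 2 / 2 + x j 0 ^+ 2 / 2)))//.
  apply: ler_sum => i _; rewrite (le_trans (ler_norm_sum _ _ _))//.
  apply: ler_sum => j _; rewrite normrM ger0_norm// ler_wpM2l//.
  have := sqr_ge0 (x i 0 + x j 0); have := sqr_ge0 (x i 0 - x j 0).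
  by rewrite sqrrB sqrrD => ? ?; rewrite ler_norml; apply/andP; split; lra.
under eq_bigr => i _ do under eq_bigr => j _ do rewrite mulrDr.
under eq_bigr => i _ do rewrite big_split/=.
rewrite big_split/= [X in _ + X]exchange_big/=.
rewrite [leRHS](_ : _ = \sum_i x i 0 ^+ 2 / 2 + \sum_i x i 0 ^+ 2 / 2); last first.
  by rewrite -big_split/=; apply: eq_bigr => i _; rewrite -splitr.
apply: lerD; apply: ler_sum => i _; rewrite -mulr_suml ler_piMl ?divr_ge0 ?sqr_ge0//.
  by rewrite sum_eq_nat lern1 leq_b1.
exact: sum_succ_ord.
Qed.

(** A chain of [n.+1] indices has [n] adjacent pairs. This evaluates the form on the extremal test
    vectors. *)
Lemma nbrsum_const n (x : 'cV[R]_n.+1) (a : R) :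
  (forall i j : 'I_n.+1, (j : nat) = i.+1 -> x i 0 * x j 0 = a) ->
  nbrsum x = a * n%:R.
Proof.
move=> xa; rewrite /nbrsum.
transitivity (\sum_(i < n.+1) (i.+1 < n.+1)%:R * a).
  apply: eq_bigr => i _; rewrite -sum_eq_nat mulr_suml; apply: eq_bigr => j _.
  by case: eqP => [/xa ->//|_]; rewrite !mul0r.
rewrite -mulr_suml big_ord_recr/= ltnn addr0 mulrC; congr (_ * _).
rewrite (eq_bigr (fun=> 1)); first by rewrite sumr_const card_ord.
by move=> i _; rewrite ltnS ltn_ord.
Qed.

Lemma quadformE n (A : 'M[R]_n) (x : 'cV[R]_n) :
  quadform A x = \sum_i \sum_j A i j * (x i 0 * x j 0).
Proof.
apply: eq_bigr => i _; rewrite mxE mulr_sumr; apply: eq_bigr => j _.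
by rewrite mulrCA.
Qed.

Lemma quadformZ n (a : R) (A : 'M[R]_n) (x : 'cV[R]_n) :
  quadform (a *: A) x = a * quadform A x.
Proof.
rewrite !quadformE mulr_sumr; apply: eq_bigr => i _; rewrite mulr_sumr.
by apply: eq_bigr => j _; rewrite mxE -mulrA.
Qed.

(* Swapping the summation indices of the subdiagonal half turns [d_i - d_j]
   into the constant coefficient [- b]. *)
Lemma quadform_diag_tridiag n (a b k : R) (x : 'cV[R]_n) :
  quadform (diag_mx (\row_(i < n) (a + i.+1%:R * b)) *m
            (k *: tridiag n (-1) 0 1)) x = - (b * k) * nbrsum x.
Proof.
pose d (i : 'I_n) := a + i.+1%:R * b.
rewrite quadformE.
transitivity (\sum_(i < n) \sum_(j < n) k * d i * ((j : nat) == i.+1)%:R * (x i 0 * x j 0)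
  - \sum_(i < n) \sum_(j < n) k * d i * ((i : nat) == j.+1)%:R * (x i 0 * x j 0)).
  rewrite -sumrB; apply: eq_bigr => i _; rewrite -sumrB; apply: eq_bigr => j _.
  rewrite mul_diag_mx !mxE -/(d i).
  have -> : (if (j : nat) == i.+1 then 1 else if (i : nat) == j.+1 then -1
             else if (i : nat) == j then 0 else 0 : R)
     = ((j : nat) == i.+1)%:R - ((i : nat) == j.+1)%:R.
    case: eqP => [->|_]; first by rewrite (ltn_eqF (leqW (leqnn _))) subr0.
    by case: eqP => _; [rewrite sub0r|rewrite subr0 if_same].
  by ring.
rewrite [X in _ - X]exchange_big/= -sumrB /nbrsum mulr_sumr.
apply: eq_bigr => i _; rewrite -sumrB mulr_sumr; apply: eq_bigr => j _.
case: eqP => [ji|_]; last by rewrite !(mulr0, mul0r) subrr.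
by rewrite /d ji -[in X in _ - X]natr1; ring.
Qed.

(** * Kronecker products with the identity, slice by slice *)

Lemma sum_mxtens m n (F : 'I_(m * n) -> R) :
  \sum_k F k = \sum_(a < m) \sum_(b < n) F (mxtens_index (a, b)).
Proof.
rewrite pair_bigA/= (reindex (@mxtens_index m n))/=.
  by apply: eq_bigr => -[a b] _.
by exists (@mxtens_unindex m n) => k _; rewrite ?mxtens_indexK ?mxtens_unindexK.
Qed.

(** The slices decouple the two Kronecker products: [1%:M *t B] acts as [B] on every [rowblock], and
    [B *t 1%:M] as [B] on every [colblock]. *)
Definition rowblock m n (x : 'cV[R]_(m * n)) (a : 'I_m) : 'cV[R]_n :=
  \col_b x (mxtens_index (a, b)) 0.

Definition colblock m n (x : 'cV[R]_(m * n)) (b : 'I_n) : 'cV[R]_m :=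
  \col_a x (mxtens_index (a, b)) 0.

Lemma sqnorm_rowblock m n (x : 'cV[R]_(m * n)) :
  sqnorm x = \sum_a sqnorm (rowblock x a).
Proof.
rewrite /sqnorm sum_mxtens; apply: eq_bigr => a _.
by apply: eq_bigr => b _; rewrite mxE.
Qed.

Lemma sqnorm_colblock m n (x : 'cV[R]_(m * n)) :
  sqnorm x = \sum_b sqnorm (colblock x b).
Proof.
rewrite /sqnorm sum_mxtens exchange_big; apply: eq_bigr => b _.
by apply: eq_bigr => a _; rewrite mxE.
Qed.

Lemma sum_delta n (i : 'I_n) (F : 'I_n -> R) :
  \sum_j (i == j)%:R * F j = F i.
Proof.
rewrite (bigD1 i)//= eqxx mul1r big1 ?addr0// => j.
by rewrite eq_sym => /negbTE ->; rewrite mul0r.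
Qed.

Lemma quadform_tens1mx m n (B : 'M[R]_n) (x : 'cV[R]_(m * n)) :
  quadform ((1%:M : 'M[R]_m) *t B) x = \sum_a quadform B (rowblock x a).
Proof.
rewrite quadformE sum_mxtens; apply: eq_bigr => a _; rewrite quadformE.
apply: eq_bigr => b _; rewrite sum_mxtens exchange_big; apply: eq_bigr => b' _.
under eq_bigr => a' _ do rewrite tensmxE mxE -!mulrA.
by rewrite sum_delta !mxE.
Qed.

Lemma quadform_tensmx1 m n (B : 'M[R]_m) (x : 'cV[R]_(m * n)) :
  quadform (B *t (1%:M : 'M[R]_n)) x = \sum_b quadform B (colblock x b).
Proof.
rewrite quadformE sum_mxtens exchange_big; apply: eq_bigr => b _.
rewrite quadformE; apply: eq_bigr => a _; rewrite sum_mxtens.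
apply: eq_bigr => a' _.
under eq_bigr => b' _ do rewrite tensmxE [1%:M _ _]mxE mulrAC mulrC.
by rewrite sum_delta !mxE.
Qed.

End CentralDifference.

(** * The two advection matrices and sharpness of the bounds *)

Section AdvectionMatrices.
Variable R : realType.

(** The step [dS] of the progression cancels against the factor [1 / (2 dS)] of the difference
    quotient, so the coefficient is independent of the mesh. *)
Lemma quadform_D1L1 (L S : R) m (x : 'cV[R]_m) : L < S ->
  quadform (D1 L S m *m L1 L S m) x = - 2^-1 * nbrsum x.
Proof.
move=> LS; rewrite quadform_diag_tridiag; congr (- _ * _).
have : dS L S m != 0 by rewrite mulf_neq0 ?invr_eq0 ?pnatr_eq0// subr_eq0 gt_eqF.
by move=> h0; field.
Qed.

Lemma quadform_D2L2 (eta V : R) m (x : 'cV[R]_m) : 0 < V ->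
  quadform ((eta%:M - D2 V m) *m L2 V m) x = 2^-1 * nbrsum x.
Proof.
move=> V0.
(* Seen as a progression, this diagonal has step [- dV]; the negative step reverses the sign of the
   form compared with [D1]. *)
have -> : eta%:M - D2 V m = diag_mx (\row_(i < m) (eta + i.+1%:R * - dV V m)).
  rewrite -diag_const_mx /D2 -raddfB/=; congr diag_mx.
  by apply/rowP => i; rewrite !mxE mulrN.
rewrite quadform_diag_tridiag; congr (_ * _).
have : dV V m != 0 by rewrite mulf_neq0 ?invr_eq0 ?pnatr_eq0// gt_eqF.
by move=> h0; field.
Qed.

Lemma quadform_A1 (r L S : R) m1 m2 (x : 'cV[R]_(m2 * m1)) : L < S ->
  quadform (A1 r L S m1 m2) x = - (r / 2) * \sum_a nbrsum (rowblock x a).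
Proof.
move=> LS; rewrite quadformZ quadform_tens1mx mulNr -mulrN -mulrA; congr (_ * _).
rewrite -sumrN mulr_sumr; apply: eq_bigr => a _.
by rewrite quadform_D1L1// mulNr mulrN.
Qed.

Lemma quadform_A2 (kappa eta V : R) m1 m2 (x : 'cV[R]_(m2 * m1)) : 0 < V ->
  quadform (A2 kappa eta V m1 m2) x = kappa / 2 * \sum_b nbrsum (colblock x b).
Proof.
move=> V0; rewrite quadformZ quadform_tensmx1 -mulrA; congr (_ * _).
by rewrite mulr_sumr; apply: eq_bigr => a _; rewrite quadform_D2L2.
Qed.

(** If [w < a], the hypothesis reads [(a - w) m <= w], which fails as soon as [m] exceeds
    [w / (a - w)]. *)
Lemma le_of_mean_le (a w : R) :
  (forall m : nat, (3 <= m)%N -> a * m%:R <= w * m.+1%:R) -> a <= w.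
Proof.
move=> aw; rewrite leNgt; apply/negP => wa.
have aw0 : 0 < a - w by rewrite subr_gt0.
have := truncnS_gt (w / (a - w)); set k := Num.truncn _.
(* Adding 3 to [k] keeps the index admissible and beyond the threshold. *)
rewrite ltr_pdivrMr// => wk; have := aw (k + 3)%N (leq_addl _ _).
rewrite -natr1 natrD -natr1 in wk *; nra.
Qed.

End AdvectionMatrices.

Theorem theorem2p1 (R : realType) (r kappa eta L S V : R)
  (hr : 0 < r) (hkappa : 0 < kappa) (heta : 0 < eta)
  (hL : 0 <= L) (hLS : L < S) (hV : 0 < V) :
  (forall (m1 m2 : nat), (3 <= m1)%N -> (3 <= m2)%N ->
     forall t : R, 0 <= t ->
       specnorm (mexp (t *: A1 r L S m1 m2)) <= expR (t * (r / 2)) /\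
       specnorm (mexp (t *: A2 kappa eta V m1 m2)) <= expR (t * (kappa / 2))) /\
  (forall omega : R,
     (forall (m1 m2 : nat), (3 <= m1)%N -> (3 <= m2)%N ->
        forall t : R, 0 <= t ->
          specnorm (mexp (t *: A1 r L S m1 m2)) <= expR (t * omega)) ->
     r / 2 <= omega) /\
  (forall omega : R,
     (forall (m1 m2 : nat), (3 <= m1)%N -> (3 <= m2)%N ->
        forall t : R, 0 <= t ->
          specnorm (mexp (t *: A2 kappa eta V m1 m2)) <= expR (t * omega)) ->
     kappa / 2 <= omega).
Proof.
split; [|split].
- move=> m1 m2 _ _ t t0; split; apply: specnorm_mexp_le => // x.
  (* The bound on [nbrsum] is on its absolute value, so it also covers the negative sign in the form
     of [A1]. *)
  + rewrite quadform_A1// mulNr -mulrN ler_pM2l ?divr_gt0//.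
    rewrite sqnorm_rowblock -sumrN; apply: ler_sum => a _.
    by rewrite (le_trans _ (normr_nbrsum_le _))// -normrN ler_norm.
  + rewrite quadform_A2// ler_pM2l ?divr_gt0//.
    rewrite sqnorm_colblock; apply: ler_sum => b _.
    by rewrite (le_trans _ (normr_nbrsum_le _))// ler_norm.
- move=> w Aw; apply: le_of_mean_le => m m3.
  (* The signs alternate along the [m1] direction only, so all adjacent products in a row are -1 and
     cancel the minus sign of the form. Only [m1 = m.+1] is refined; [m2 = 3] gives three identical
     rows, a common factor on both sides. *)
  pose x : 'cV[R]_(3 * m.+1) := \col_k (-1) ^+ (mxtens_unindex k).2.
  have := quadform_le_specnorm_mexp (Aw m.+1 3 (leqW m3) isT) x.
  rewrite quadform_A1// sqnorm_rowblock.
  rewrite (eq_bigr (fun=> - m%:R)); last first.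
    move=> a _; rewrite (@nbrsum_const _ _ _ (-1)) ?mulN1r// => i j ij.
    by rewrite !mxE !mxtens_indexK/= ij exprS mulrCA -expr2 sqrr_sign mulr1.
  rewrite [X in w * X](eq_bigr (fun=> m.+1%:R)); last first.
    move=> a _; rewrite /sqnorm (eq_bigr (fun=> 1)) ?sumr_const ?card_ord//.
    by move=> i _; rewrite !mxE sqrr_sign.
  rewrite !sumr_const !card_ord; lra.
- move=> w Aw; apply: le_of_mean_le => m m3.
  (* Here [m2 = m.+1] is refined and [m1 = 3] stays fixed; the form of [A2] has a positive sign, so
     adjacent products equal to 1 are wanted. *)
  pose x : 'cV[R]_(m.+1 * 3) := const_mx 1.
  have := quadform_le_specnorm_mexp (Aw 3 m.+1 isT (leqW m3)) x.
  rewrite quadform_A2// sqnorm_colblock.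
  rewrite (eq_bigr (fun=> m%:R)); last first.
    move=> b _; rewrite (@nbrsum_const _ _ _ 1) ?mul1r// => i j ij.
    by rewrite !mxE mulr1.
  rewrite [X in w * X](eq_bigr (fun=> m.+1%:R)); last first.
    move=> b _; rewrite /sqnorm (eq_bigr (fun=> 1)) ?sumr_const ?card_ord//.
    by move=> i _; rewrite !mxE expr1n.
  rewrite !sumr_const !card_ord; lra.
Qed.
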